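(* Let $t_g$ be a gauged stable ribbon tree of arity $n\geqslant 2$ whose gauge intersects exactly $j$ vertices, with underlying stable ribbon tree $t$ and orientation $\omega=e_1\wedge\cdots\wedge e_i$. Let $e_p$ be an internal edge of $t$ not intersecting the gauge whose collapse gives a codimension one stratum $\mathcal{CT}_n((t/e_p)_g)$ of the boundary of $\overline{\mathcal{CT}}_n(t_g)$ (an int-collapse boundary component), and let $\omega_p:=e_1\wedge\cdots\wedge\widehat{e_p}\wedge\cdots\wedge e_i$. Then the boundary component $\mathcal{CT}_n((t/e_p)_g,\omega_p)$ bears a $(-1)^{p+1+j}$ sign in the boundary of $\overline{\mathcal{CT}}_n(t_g,\omega)$.
   Context: A ribbon tree is a planar rooted tree with one outgoing external edge, whose adjacent vertex is the root $r$, and $n$ incoming external edges ordered from left to right; it is stable if all vertices are at least trivalent. $E(t)$ is its set of internal edges, $e(t)=|E(t)|$. An orientation of $t$ is an ordering $e_1\wedge\cdots\wedge e_i$ of $E(t)$ up to even permutation. A gauged stable ribbon tree $t_g$ is a stable ribbon tree $t$ with a partition of its vertices into vertices below the gauge (between gauge and outgoing edge), on the gauge (intersected by it), and above the gauge, such that the parent (next vertex towards $r$) of any vertex below or on the gauge is below the gauge. An edge intersects the gauge if its lower end is below and its upper end above the gauge. $\mathcal{CT}_n(t_g)$ is the polyhedral cone of $(\lambda,(l_e)_{e\in E(t)})\in\mathbb R\times\,]0,+\infty[^{e(t)}$ with $-\lambda>d(r,v)$ for $v$ below, $-\lambda=d(r,v)$ for $v$ on, $-\lambda<d(r,v)$ for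 $v$ above the gauge ($d(r,v)$ = sum of the lengths on the path from $r$ to $v$). It has dimension $e(t)+1-j$ if $j$ vertices are on the gauge. An orientation $\omega$ of $t$ orients it, giving $\mathcal{CT}_n(t_g,\omega)$: if $j=0$, as an open subset of $\mathbb R\times\,]0,+\infty[^{e(t)}$ (coordinate $\lambda$ first, then the lengths ordered by $\omega$); in general, with $v_1,\dots,v_j$ the vertices on the gauge from left to right and $\nu_k$ a vector outward-pointing for the half-space $-\lambda\geqslant d(r,v_k)$ (e.g. the gradient of $\lambda+d(r,v_k)$), it is cooriented by $(\nu_1,\dots,\nu_j)$, i.e. a basis of its tangent space is positive iff its concatenation after $(\nu_1,\dots,\nu_j)$ is positive. Compactification: let $t_c$ be obtained by colouring the vertices on the gauge and adding a coloured vertex at each intersection of the gauge with the interior of an edge; points of $\mathcal{CT}_n(t_g)$ are lengths of the internal edges of $t_c$ such that all paths from coloured vertices to $r$ have equal length; $\overline{\mathcal{CT}}_n(t_g)$ is obtained by letting these lengths go to $0$ (edge collapses) or $+\infty$ (edge breaks) subject to these equalities. $(t/e_p)_g$ is obtained by collapsing $e_p$; the new vertex is on the gauge if one end of $e_p$ was, and otherwise on the same side as both ends. A codimension one stratum with a given orientation bears the sign $\varepsilon$ in the boundary if the boundary orientation (outward-pointing vector first) is $\varepsilon$ times the given one. *)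

(* Defs.v *)
From HB Require Import structures.
From mathcomp Require Import all_boot all_order all_algebra.
From mathcomp Require Import all_classical all_reals all_analysis.
Import Order.TTheory GRing.Theory Num.Theory.
Import numFieldNormedType.Exports.

Set Implicit Arguments.
Unset Strict Implicit.
Unset Printing Implicit Defensive.

Local Open Scope classical_set_scope.
Local Open Scope ring_scope.

(** * Ribbon trees *)

(* [Node v ts] is a vertex named [v] with its incoming edges listed from left to
   right; [Leaf] is the free end of an incoming external edge.  Names only serve
   to identify vertices and are required to be distinct ([ribbon_tree]). *)
Inductive tree (V : Type) : Type :=
| Leaf
| Node of V & seq (tree V).
Arguments Leaf {V}.

Fixpoint vertices (V : Type) (t : tree V) : seq V :=
  if t is Node v ts then v :: flatten [seq vertices s | s <- ts] else [::].

(* Pairs (lower end, upper end).  An internal edge is named by its upper end,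
   which survives the collapse of any other edge, whereas its lower end may be
   renamed. *)
Fixpoint edges (V : Type) (t : tree V) : seq (V * V) :=
  if t is Node v ts then
    flatten [seq if s is Node w _ then (v, w) :: edges s else [::] | s <- ts]
  else [::].

Definition internal_edges (V : Type) (t : tree V) : seq V :=
  [seq e.2 | e <- edges t].

(* The lower ends of the incoming external edges, from left to right. *)
Fixpoint incoming (V : Type) (t : tree V) : seq V :=
  if t is Node v ts then
    flatten [seq if s is Leaf then [:: v] else incoming s | s <- ts]
  else [::].

Definition arity (V : Type) (t : tree V) : nat := size (incoming t).

Definition ribbon_tree (V : eqType) (t : tree V) : Prop :=
  t <> Leaf /\ uniq (vertices t).

(* With its outgoing edge, a vertex is at least trivalent iff it has at least
   two incoming edges. *)
Fixpoint stable (V : Type) (t : tree V) : bool :=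
  if t is Node _ ts then (1 < size ts)%N && all (@stable V) ts else true.

(* The internal edges on the path from the root to [v]. *)
Fixpoint path_to (V : eqType) (v : V) (t : tree V) : seq V :=
  if t is Node u ts then
    flatten [seq if s is Node w _
                 then (if v \in vertices s then w :: path_to v s else [::])
                 else [::] | s <- ts]
  else [::].

(* The vertex created by the collapse of an edge keeps the name of its lower
   end, so that the internal edges of [collapse e t] are those of [t] except
   [e], under the same names. *)
Fixpoint collapse (V : eqType) (e : V) (t : tree V) : tree V :=
  if t is Node v ts then
    Node v (flatten [seq if s is Node w us
                         then (if w == e then us else [:: collapse e s])
                         else [:: Leaf] | s <- ts])
  else Leaf.

Definition ordering (V : eqType) (t : tree V) (w : seq V) : Prop :=
  uniq w /\ perm_eq w (internal_edges t).

(** * Gauges *)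

Inductive side := Below | On | Above.

Definition side_eqb (a b : side) : bool :=
  match a, b with
  | Below, Below | On, On | Above, Above => true
  | _, _ => false
  end.

Lemma side_eqP : Equality.axiom side_eqb.
Proof. by do 2!case; constructor. Qed.
HB.instance Definition _ := hasDecEq.Build side side_eqP.

Definition gauged (V : eqType) (t : tree V) (g : V -> side) : Prop :=
  forall u v, (u, v) \in edges t -> g v = Below \/ g v = On -> g u = Below.

(* Distinct vertices on the gauge are never on a common path to the root, so the
   depth-first order lists them from left to right. *)
Definition on_gauge (V : eqType) (t : tree V) (g : V -> side) : seq V :=
  [seq v <- vertices t | g v == On].

Definition intersects (V : eqType) (g : V -> side) (e : V * V) : bool :=
  (g e.1 == Below) && (g e.2 == Above).

Definition collapse_gauge (V : eqType) (t : tree V) (g : V -> side) (e : V) :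
    V -> side :=
  fun x => if ((x, e) \in edges t) && (g e == On) then On else g x.

(** * The polyhedral cones *)

Section Cone.
Variables (R : realType) (V : eqType) (t : tree V) (g : V -> side) (w : seq V).

(* Coordinate 0 is lambda, coordinate k.+1 is the length of the k-th edge of
   the ordering [w]. *)
Local Notation E := 'rV[R]_(size w).+1.

Definition lambda (x : E) : R := x 0 ord0.

Definition edge_length (x : E) (e : V) : R :=
  if e \in w then x 0 (inord (index e w).+1) else 0.

Definition dist (x : E) (v : V) : R :=
  \sum_(e <- path_to v t) edge_length x e.

Definition CT : set E := [set x |
  (forall e, e \in w -> 0 < edge_length x e) /\
  (forall v, v \in vertices t ->
     match g v return Prop with
     | Below => dist x v < - lambda x
     | On => - lambda x = dist x v
     | Above => - lambda x < dist x v
     end)].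

(* The gradient of [fun x => lambda x + dist x v]. *)
Definition conormal (v : V) : E :=
  \row_k (if k == ord0 then 1
          else if nth v w k.-1 \in path_to v t then 1 else 0).

(* +1 on positive bases of the tangent space of [CT], -1 on negative ones: the
   basis is appended to the outward gradients at the vertices on the gauge, from
   left to right.  (Other outward-pointing vectors would not do: for two or more
   vertices they need not induce the same coorientation.) *)
Definition orientation (b : seq E) : R :=
  let f := [seq conormal v | v <- on_gauge t g] ++ b in
  Num.sg (\det (\matrix_(i < (size w).+1) f`_i)).

(* Internal edges (lower end, upper end) of the tree t_c, where [None] stands
   for a coloured vertex added in the interior of an edge of [t].  The gauge
   intersects an incoming edge iff its lower end is below the gauge, and the
   outgoing edge iff the root is above the gauge. *)
Definition coloured_edges : seq (option V * option V) :=
  (if t is Node r _ then (if g r == Above then [:: (None, Some r)] else [::])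
   else [::]) ++
  flatten [seq if intersects g e
               then [:: (Some e.1, None); (None, Some e.2)]
               else [:: (Some e.1, Some e.2)] | e <- edges t] ++
  [seq (Some v, None) | v <- incoming t & g v == Below].

Definition height (x : E) (c : option V) : R :=
  if c is Some v then dist x v else - lambda x.

(* The lengths of the internal edges of t_c. *)
Definition coloured_lengths (x : E) :
    prod_topology (fun _ : 'I_(size coloured_edges) => \bar R) :=
  fun k => let e := nth (None, None) coloured_edges k in
           (height x e.2 - height x e.1)%:E.

(* The closure in the space of all families of lengths in \bar R: lengths may
   tend to 0 or to +oo.  (Imposing the equalities between path lengths on the
   limits would not be enough: above an infinite edge they say nothing.) *)
Definition CTbar :
    set (prod_topology (fun _ : 'I_(size coloured_edges) => \bar R)) :=
  closure (coloured_lengths @` CT).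

Definition CTboundary :
    set (prod_topology (fun _ : 'I_(size coloured_edges) => \bar R)) :=
  CTbar `\` coloured_lengths @` CT.

(* For [y] on a codimension one stratum of the boundary with finite lengths:
   near [y], the compactification is then a closed half-space of the linear span
   of [CT], and [CT] is the corresponding open half-space. *)
Definition outward (y v : E) : Prop :=
  exists2 d : R, 0 < d & forall s : R, 0 < s < d ->
    CT (y - s *: v) /\ ~ CTbar (coloured_lengths (y + s *: v)).

End Cone.

Arguments CT {R V} t g w.
Arguments CTbar R {V} t g w.
Arguments CTboundary R {V} t g w.
Arguments coloured_lengths {R V} t g {w} x.
Arguments orientation {R V} t g {w} b.
Arguments outward {R V} t g {w} y v.

(* For [S] open in its affine hull, as the cones are. *)
Definition tangent (R : realType) (m : nat) (S : set 'rV[R]_m) (x : 'rV[R]_m) :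
    set 'rV[R]_m :=
  [set v | \forall s \near (0 : R), S (x + s *: v)].

Definition tangent_basis (R : realType) (m : nat) (S : set 'rV[R]_m)
    (x : 'rV[R]_m) (b : seq 'rV[R]_m) : Prop :=
  free b /\ forall v, tangent S x v <-> v \in <<b>>%VS.

Definition has_dim (R : realType) (m : nat) (S : set 'rV[R]_m) (d : nat) : Prop :=
  S !=set0 /\
  forall x, S x -> exists2 b, tangent_basis S x b & size b = d.

(** * Collapsing an edge *)

Section Collapse.
Variables (R : realType) (V : eqType) (t : tree V) (g : V -> side).
Variables (w : seq V) (e : V).

Definition collapse_CT : set 'rV[R]_(size (rem e w)).+1 :=
  CT (collapse e t) (collapse_gauge t g e) (rem e w).

(* The inclusion (lambda, l) |-> (lambda, l with l_e = 0); being linear, it also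
   acts on tangent vectors. *)
Definition collapse_incl (x : 'rV[R]_(size (rem e w)).+1) : 'rV[R]_(size w).+1 :=
  \row_k (if k == ord0 then lambda x else edge_length x (nth e w k.-1)).

Definition int_collapse : Prop :=
  [/\ forall u, (u, e) \in edges t -> ~~ intersects g (u, e),
      gauged (collapse e t) (collapse_gauge t g e),
      forall x, collapse_CT x ->
        CTboundary R t g w (coloured_lengths t g (collapse_incl x)) &
      exists2 d, has_dim collapse_CT d & has_dim (CT t g w : set 'rV[R]_(size w).+1) d.+1].

Definition collapse_bears_sign (eps : R) : Prop :=
  forall x, collapse_CT x ->
    (exists v, outward t g (collapse_incl x) v) /\
    forall v b, outward t g (collapse_incl x) v -> tangent_basis collapse_CT x b ->
      orientation t g (v :: [seq collapse_incl y | y <- b]) =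
      eps * orientation (collapse e t) (collapse_gauge t g e) b.

End Collapse.

(* Main.v *)
Require Import Defs.
From mathcomp Require Import all_boot all_order all_algebra.
From mathcomp Require Import all_classical all_reals all_analysis.
From mathcomp Require Import lra.
Import Order.TTheory GRing.Theory Num.Theory.
Local Open Scope ring_scope.

Set Implicit Arguments.
Unset Strict Implicit.
Unset Printing Implicit Defensive.

(** Collapsing [e] identifies the stratum with the face of the cone on which the
   length of [e] vanishes; the gradients at the vertices on the gauge restrict to
   the gradients at the vertices on the gauge of the collapsed tree, in the same
   order (if [e] ends on the gauge, the merged vertex takes the place of its
   upper end).  An outward vector [v] is orthogonal to these gradients and has a
   negative coordinate along [e], whereas the tangent vectors of the stratum have
   coordinate zero there.  Expanding the determinant of (gradients, [v], basis of
   the stratum) along the row of [v], of index [j], only the minor of column [p]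
   matters for the sign, which is therefore [-(-1)^(j+p)]. *)

(** * Ribbon trees *)

Section Forest.
Variable V : eqType.
Implicit Types (t s : tree V) (ts us : seq (tree V)) (u v e a b x : V).

(** Names for the [flatten] expressions in the bodies of [vertices], [edges], [path_to] and
    [collapse], so that a statement on trees has a convertible counterpart on lists of subtrees. *)
Definition forest_vertices ts : seq V := flatten [seq vertices s | s <- ts].

Definition forest_edges v ts : seq (V * V) :=
  flatten [seq if s is Node w _ then (v, w) :: edges s else [::] | s <- ts].

Definition forest_path x ts : seq V :=
  flatten [seq if s is Node w _
               then (if x \in vertices s then w :: path_to x s else [::])
               else [::] | s <- ts].

Definition forest_collapse e ts : seq (tree V) :=
  flatten [seq if s is Node w us
               then (if w == e then us else [:: collapse e s])
               else [:: Leaf] | s <- ts].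

(** Subtrees are nested in a [seq], so trees and lists of subtrees are handled by one simultaneous
    induction. *)
Lemma tree_forest_ind (P : tree V -> Prop) (Q : seq (tree V) -> Prop) :
    P Leaf -> (forall v ts, Q ts -> P (Node v ts)) ->
    Q [::] -> (forall s ts, P s -> Q ts -> Q (s :: ts)) ->
  (forall t, P t) /\ (forall ts, Q ts).
Proof.
move=> PL PN Q0 Qc.
have HP : forall t, P t.
  fix IH 1 => -[|v ts]; first exact: PL.
  apply: PN; elim: ts => [|s ts IHts]; first exact: Q0.
  by apply: Qc; [exact: IH | exact: IHts].
by split=> //; elim=> // s ts IHts; apply: Qc.
Qed.

Lemma forest_vertices_cons s ts :
  forest_vertices (s :: ts) = vertices s ++ forest_vertices ts.
Proof. by []. Qed.

Lemma forest_edges_cons v w us ts :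
  forest_edges v (Node w us :: ts) =
  (v, w) :: edges (Node w us) ++ forest_edges v ts.
Proof. by []. Qed.

Lemma forest_path_cons x w us ts :
  forest_path x (Node w us :: ts) =
  (if x \in vertices (Node w us) then w :: path_to x (Node w us) else [::]) ++
  forest_path x ts.
Proof. by []. Qed.

Lemma forest_collapse_cons e w us ts :
  forest_collapse e (Node w us :: ts) =
  (if w == e then us else [:: collapse e (Node w us)]) ++ forest_collapse e ts.
Proof. by []. Qed.

(** Each vertex of the subtrees is the upper end of exactly one edge, and both traversals are
    depth-first. *)
Lemma forest_internal_edges v ts :
  [seq ab.2 | ab <- forest_edges v ts] = forest_vertices ts.
Proof.
refine ((@tree_forest_ind
  (fun t => if t is Node r us then
     [seq ab.2 | ab <- edges t] = forest_vertices us else True)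
  (fun ts => forall v, [seq ab.2 | ab <- forest_edges v ts] = forest_vertices ts)
  _ _ _ _).2 ts v) => // [r us IH|]; first exact: IH.
move=> [|w us] rs IHs IHrs r; first exact: IHrs.
rewrite /forest_edges /forest_vertices /= map_cat -/(forest_edges r rs) IHrs.
by congr (_ :: _); rewrite [in LHS]IHs.
Qed.

Lemma internal_edges_Node v ts :
  internal_edges (Node v ts) = forest_vertices ts.
Proof. exact: forest_internal_edges. Qed.

Lemma internal_edges_sub t : {subset internal_edges t <= vertices t}.
Proof.
by case: t => // v ts x; rewrite internal_edges_Node /= inE => ->; rewrite orbT.
Qed.

Lemma forest_edges_upper v ts a b :
  (a, b) \in forest_edges v ts -> b \in forest_vertices ts.
Proof.
by move=> abE; rewrite -(forest_internal_edges v); apply/mapP; exists (a, b).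
Qed.

Lemma edges_upper t a b : (a, b) \in edges t -> b \in vertices t.
Proof.
by move=> abE; apply/internal_edges_sub/mapP; exists (a, b).
Qed.

Lemma edges_lower t a b : (a, b) \in edges t -> a \in vertices t.
Proof.
refine ((@tree_forest_ind
  (fun t => forall a b, (a, b) \in edges t -> a \in vertices t)
  (fun ts => forall v a b, (a, b) \in forest_edges v ts ->
     a \in v :: forest_vertices ts) _ _ _ _).1 t a b) => //.
  by move=> v ts IH a' b' /IH.
move=> [|w us] rs IHs IHrs r c d; first exact: IHrs.
rewrite forest_vertices_cons forest_edges_cons in_cons mem_cat in_cons mem_cat.
case/or3P=> [/eqP[-> _]|/IHs->|/IHrs]; rewrite ?eqxx ?orbT //.
by rewrite in_cons => /orP[->|->]; rewrite ?orbT.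
Qed.

Lemma forest_edges_lower v ts a b :
  (a, b) \in forest_edges v ts -> a \in v :: forest_vertices ts.
Proof. exact: (@edges_lower (Node v ts)). Qed.

(** Induction along the edges, from the root upwards; it propagates facts about paths and gauges. *)
Lemma vertex_ind r ts (C : V -> Prop) :
    C r -> (forall a b, (a, b) \in edges (Node r ts) -> C a -> C b) ->
  {in vertices (Node r ts), forall x, C x}.
Proof.
refine ((@tree_forest_ind
  (fun t => if t is Node r _ then C r ->
     (forall a b, (a, b) \in edges t -> C a -> C b) ->
     {in vertices t, forall x, C x} else True)
  (fun ts => forall v, C v ->
     (forall a b, (a, b) \in forest_edges v ts -> C a -> C b) ->
     {in forest_vertices ts, forall x, C x}) _ _ _ _).1 (Node r ts)) => {r ts} //.
  move=> v ts IH Cv CE x; rewrite inE => /orP[/eqP->//|]; exact: (IH v).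
move=> [|w us] rs IHs IHrs v Cv CE x; first exact: (IHrs v).
rewrite forest_vertices_cons mem_cat => /orP[|]; last first.
  apply: (IHrs v) => // a b abE; apply: CE.
  by rewrite forest_edges_cons in_cons mem_cat abE !orbT.
apply: IHs.
  by apply: (CE v) => //; rewrite /forest_edges /= inE eqxx.
by move=> a b abE; apply: CE; rewrite forest_edges_cons in_cons mem_cat abE orbT.
Qed.

Lemma path_to_subseq x t : subseq (path_to x t) (internal_edges t).
Proof.
refine ((@tree_forest_ind
  (fun t => subseq (path_to x t) (internal_edges t))
  (fun ts => subseq (forest_path x ts) (forest_vertices ts)) _ _ _ _).1 t) => //.
  by move=> v ts; rewrite internal_edges_Node.
move=> [|w us] rs IHs IHrs //.
rewrite forest_path_cons forest_vertices_cons; apply: cat_subseq => //.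
case: ifP => _; first by rewrite internal_edges_Node in IHs; rewrite /= eqxx.
exact: sub0seq.
Qed.

Lemma forest_path_notin x ts :
  x \notin forest_vertices ts -> forest_path x ts = [::].
Proof.
elim: ts => // -[|w us] ts IH; first exact: IH.
rewrite forest_vertices_cons forest_path_cons mem_cat negb_or.
by case/andP=> /negPf-> /IH.
Qed.

Lemma path_to_root r ts :
  uniq (vertices (Node r ts)) -> path_to r (Node r ts) = [::].
Proof. by case/andP=> /forest_path_notin. Qed.

(** Distinct names put each vertex in a single child, so at most one branch of the [flatten]
    contributes to a path. *)
Lemma path_to_edge t a b :
    uniq (vertices t) -> (a, b) \in edges t ->
  path_to b t = rcons (path_to a t) b.
Proof.
refine ((@tree_forest_ind
  (fun t => forall a b, uniq (vertices t) -> (a, b) \in edges t ->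
     path_to b t = rcons (path_to a t) b)
  (fun ts => forall v a b, uniq (v :: forest_vertices ts) ->
     (a, b) \in forest_edges v ts ->
     forest_path b ts = rcons (forest_path a ts) b) _ _ _ _).1 t a b) => //.
  by move=> v ts IH c d; apply: IH.
move=> [|w us] rs IHs IHrs v c d; first exact: IHrs.
rewrite forest_vertices_cons cons_uniq mem_cat negb_or cat_uniq.
case/andP=> /andP[vs vrs] /and3P[Us /hasPn sr Urs].
rewrite forest_edges_cons in_cons mem_cat !forest_path_cons => /or3P[/eqP[-> ->]|cdE|cdE].
- rewrite (negPf vs) (forest_path_notin vrs) mem_head path_to_root //=.
  by rewrite forest_path_notin //; apply/negP => /sr; rewrite /= inE eqxx.
- rewrite (edges_upper cdE) (edges_lower cdE) (IHs _ _ Us cdE).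
  rewrite !forest_path_notin ?cats0 //; apply/negP => /sr /negP; apply.
    exact: edges_lower cdE.
  exact: edges_upper cdE.
- have drs := forest_edges_upper cdE.
  have crs := forest_edges_lower cdE.
  rewrite (negPf (sr _ drs)) (IHrs v c d) /= ?vrs //.
  (* The lower end may be [v] itself, which lies in none of the subtrees. *)
  by move: crs; rewrite inE => /orP[/eqP->|/sr]; [rewrite (negPf vs) | move/negPf->].
Qed.

End Forest.

(** * Collapsing an edge *)

Section Collapse.
Variable V : eqType.
Implicit Types (t s : tree V) (ts us : seq (tree V)) (u v e a b x : V).

(** The image of a vertex in the tree where the edge from [u] to [e] is collapsed. *)
Definition rename u e x : V := if x == e then u else x.

Lemma forest_vertices_cat ts us :
  forest_vertices (ts ++ us) = forest_vertices ts ++ forest_vertices us.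
Proof. by rewrite /forest_vertices map_cat flatten_cat. Qed.

Lemma forest_edges_cat v ts us :
  forest_edges v (ts ++ us) = forest_edges v ts ++ forest_edges v us.
Proof. by rewrite /forest_edges map_cat flatten_cat. Qed.

Lemma filter_neq_notin (e : V) (r : seq V) : e \notin r -> [seq x <- r | x != e] = r.
Proof.
by move=> er; apply/all_filterP/allP => x xr; apply: contraNneq er => <-.
Qed.

(** The children of [e] are spliced in at its place, so the depth-first order of the other vertices
    is kept. *)
Lemma forest_vertices_collapse e ts :
  uniq (forest_vertices ts) ->
  forest_vertices (forest_collapse e ts) = [seq x <- forest_vertices ts | x != e].
Proof.
refine ((@tree_forest_ind V
  (fun t => if t is Node r _ then uniq (vertices t) -> r != e ->
     vertices (collapse e t) = [seq x <- vertices t | x != e] else True)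
  (fun ts => uniq (forest_vertices ts) ->
     forest_vertices (forest_collapse e ts) =
       [seq x <- forest_vertices ts | x != e]) _ _ _ _).2 ts) => // {ts}.
  move=> r ts IH /andP[_ /IH E] re.
  by rewrite [LHS](_ : _ = r :: forest_vertices (forest_collapse e ts)) //= re E.
move=> [|w us] rs IHs IHrs; first exact: IHrs.
rewrite forest_vertices_cons forest_collapse_cons cat_uniq => /and3P[Us _ /IHrs E].
rewrite forest_vertices_cat filter_cat E; congr (_ ++ _).
have [we|we] := eqVneq w e; last by rewrite -IHs // /forest_vertices /= cats0.
move: Us; rewrite we /= eqxx /= => /andP[e_us _].
by rewrite filter_neq_notin.
Qed.

Lemma vertices_collapse e r ts : uniq (vertices (Node r ts)) -> r != e ->
  vertices (collapse e (Node r ts)) = [seq x <- vertices (Node r ts) | x != e].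
Proof.
move=> /andP[_ /forest_vertices_collapse E] re.
by rewrite [LHS](_ : _ = r :: forest_vertices (forest_collapse e ts)) //= re E.
Qed.

Definition collapse_edges u e (E : seq (V * V)) : seq (V * V) :=
  [seq (rename u e ab.1, ab.2) | ab <- E & ab.2 != e].

Lemma collapse_edges_cat u e (E F : seq (V * V)) :
  collapse_edges u e (E ++ F) = collapse_edges u e E ++ collapse_edges u e F.
Proof. by rewrite /collapse_edges filter_cat map_cat. Qed.

Lemma collapse_edges_notin u e t :
  e \notin vertices t -> collapse_edges u e (edges t) = edges t.
Proof.
move=> et; rewrite /collapse_edges (_ : [seq ab <- edges t | ab.2 != e] = edges t).
  rewrite -[RHS]map_id; apply/eq_in_map => -[a b] /edges_lower aT.
  by rewrite /rename /=; case: eqVneq aT et => // -> ->.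
by apply/all_filterP/allP => -[a b] /edges_upper bT; apply: contraNneq et => <-.
Qed.

Lemma collapse_forest_edges_root u e ts : e \notin forest_vertices ts ->
  collapse_edges u e (forest_edges e ts) = forest_edges u ts.
Proof.
elim: ts => // -[|w us] ts IH; first exact: IH.
rewrite forest_vertices_cons !forest_edges_cons mem_cat negb_or => /andP[es /IH E].
rewrite -!cat_cons collapse_edges_cat E; congr (_ ++ _).
rewrite -[LHS]/(collapse_edges u e ([:: (e, w)] ++ edges (Node w us))).
rewrite collapse_edges_cat collapse_edges_notin //.
have we : w != e by apply: contraNneq es => ->; rewrite mem_head.
by rewrite /collapse_edges /= we /= /rename eqxx.
Qed.

(** The condition on the lower end of [e] is an implication so that it passes to the subtrees
    without [e], where it is vacuous. *)
Lemma forest_edges_collapse u v e ts :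
    uniq (v :: forest_vertices ts) -> v != e ->
    (forall a, (a, e) \in forest_edges v ts -> a = u) ->
  forest_edges v (forest_collapse e ts) = collapse_edges u e (forest_edges v ts).
Proof.
refine ((@tree_forest_ind V
  (fun t => if t is Node r _ then uniq (vertices t) -> r != e ->
     (forall a, (a, e) \in edges t -> a = u) ->
     edges (collapse e t) = collapse_edges u e (edges t) else True)
  (fun ts => forall v, uniq (v :: forest_vertices ts) -> v != e ->
     (forall a, (a, e) \in forest_edges v ts -> a = u) ->
     forest_edges v (forest_collapse e ts) =
       collapse_edges u e (forest_edges v ts)) _ _ _ _).2 ts v) => // {ts v}.
  by move=> r ts IH; apply: IH.
move=> [|w us] rs IHs IHrs v; first exact: IHrs.
rewrite forest_vertices_cons forest_edges_cons forest_collapse_cons.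
rewrite cons_uniq mem_cat negb_or cat_uniq.
case/andP=> /andP[vs vrs] /and3P[Us _ Urs] ve par.
rewrite forest_edges_cat -cat_cons collapse_edges_cat IHrs //=; first last.
- by move=> a aE; apply: par; rewrite in_cons mem_cat aE !orbT.
- by rewrite vrs.
congr (_ ++ _); have [we|we] := eqVneq w e.
  have <- : v = u by apply: par; rewrite we mem_head.
  move: Us => /andP[w_us _]; rewrite -(@collapse_forest_edges_root v e) -?we //.
  by rewrite /collapse_edges /= eqxx.
rewrite (_ : forest_edges v [:: _] = (v, w) :: edges (collapse e (Node w us))).
  rewrite IHs // /collapse_edges /= ?we /= /rename ?(negPf ve) //.
  by move=> a aE; apply: par; rewrite in_cons mem_cat aE orbT.
by rewrite /forest_edges /= cats0.
Qed.

Lemma collapse_edges_mem u e (E : seq (V * V)) a b :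
  (a, b) \in E -> b != e -> (rename u e a, b) \in collapse_edges u e E.
Proof.
by move=> abE be; apply/mapP; exists (a, b); rewrite // mem_filter be.
Qed.

Lemma uniq_internal_edges t : uniq (vertices t) -> uniq (internal_edges t).
Proof. by case: t => // r ts /andP[_]; rewrite internal_edges_Node. Qed.

Lemma edge_lower_unique t a b e : uniq (vertices t) ->
  (a, e) \in edges t -> (b, e) \in edges t -> a = b.
Proof.
move=> /uniq_internal_edges; rewrite /internal_edges.
elim: (edges t) => // -[c d] E IH /= /andP[dE /IH{}IH]; rewrite !in_cons.
have notE x : d = e -> (x, e) \notin E.
  by move=> de; apply: contra dE => xE; apply/mapP; exists (x, e).
case/orP=> [/eqP[-> ed]|aE] /orP[/eqP[be ed']|bE] //; last exact: IH.
- by move: (notE b (esym ed)); rewrite bE.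
- by move: (notE a (esym ed')); rewrite aE.
Qed.

(** A loop would make a path longer than itself. *)
Lemma edge_neq t u e : uniq (vertices t) -> (u, e) \in edges t -> u != e.
Proof.
move=> Ut ueE; apply/eqP => ue; have := path_to_edge Ut ueE.
by rewrite ue => /(congr1 size) /eqP; rewrite size_rcons -[eqbLHS]addn0 -addn1 eqn_add2l.
Qed.

Lemma edge_upper_neq_root r ts a b :
  uniq (vertices (Node r ts)) -> (a, b) \in edges (Node r ts) -> r != b.
Proof.
by move=> /andP[rts _] /forest_edges_upper bts; apply: contraNneq rts => ->.
Qed.

Lemma edges_collapse t u e : uniq (vertices t) -> (u, e) \in edges t ->
  edges (collapse e t) = collapse_edges u e (edges t).
Proof.
case: t => // r ts Ut ueE; apply: forest_edges_collapse => //.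
  exact: edge_upper_neq_root ueE.
by move=> a aeE; apply: edge_lower_unique ueE.
Qed.

Lemma vertices_collapse_edge t u e : uniq (vertices t) -> (u, e) \in edges t ->
  vertices (collapse e t) = [seq x <- vertices t | x != e].
Proof.
by case: t => // r ts Ut ueE; rewrite vertices_collapse ?(edge_upper_neq_root Ut ueE).
Qed.

(** Induction along the edges: an edge other than [e] extends both paths by its upper end, whereas
    [e] extends only the path in [t] and its two ends have the same image. *)
Lemma path_to_collapse t u e x :
    uniq (vertices t) -> (u, e) \in edges t -> x \in vertices t ->
  path_to (rename u e x) (collapse e t) = [seq f <- path_to x t | f != e].
Proof.
case: t => // r ts Ut ueE.
have Uc : uniq (vertices (collapse e (Node r ts))).
  by rewrite (vertices_collapse_edge Ut ueE) filter_uniq.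
have re := edge_upper_neq_root Ut ueE.
move: x; apply: vertex_ind => [|a b abE IH].
  by rewrite /rename (negPf re) (path_to_root Ut) (@path_to_root V r).
rewrite (path_to_edge Ut abE) filter_rcons -IH.
have [be|be] := eqVneq b e.
  rewrite be in abE *; rewrite (edge_lower_unique Ut abE ueE).
  by rewrite /rename eqxx (negPf (edge_neq Ut ueE)).
rewrite [rename u e b]/rename (negPf be); apply: path_to_edge => //.
by rewrite (edges_collapse Ut ueE) collapse_edges_mem.
Qed.

Lemma rename_vertices_collapse t u e x :
    uniq (vertices t) -> (u, e) \in edges t -> x \in vertices t ->
  rename u e x \in vertices (collapse e t).
Proof.
move=> Ut ueE xt; rewrite (vertices_collapse_edge Ut ueE) mem_filter /rename.
case: (eqVneq x e) => [_|xe]; last by rewrite xe.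
rewrite (edge_neq Ut ueE); exact: edges_lower ueE.
Qed.

(** * Vertices on the gauge and their behaviour under collapse *)

Lemma gauged_above r ts (g : V -> side) : uniq (vertices (Node r ts)) ->
  gauged (Node r ts) g -> g r != Below ->
  {in forest_vertices ts, forall x, g x = Above}.
Proof.
move=> Ut gt gr x xts.
(* The root itself may be on the gauge, hence the disjunction in the induction. *)
have : x = r \/ g x = Above.
  have : x \in vertices (Node r ts) by rewrite in_cons xts orbT.
  move: {xts} x; apply: vertex_ind => [|a b abE IH]; first by left.
  right; have := gt a b abE; have : g a != Below by case: IH => ->.
  by case: (g b) => // /eqP ga H; case: ga; apply: H; [left | right].
case=> // xr; move: Ut => /andP[]; by rewrite -xr xts.
Qed.

(* [u] becomes a vertex on the gauge, hence all its other descendants are above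
   the gauge, and none of them can come between [u] and [e] in [on_gauge]. *)
Lemma on_gauge_collapse_rename t (g h : V -> side) u e :
    uniq (vertices t) -> (u, e) \in edges t -> gauged (collapse e t) h ->
    g e = On -> g u != On -> h u = On -> {in predC1 u, h =1 g} ->
  on_gauge (collapse e t) h = [seq rename u e x | x <- on_gauge t g].
Proof.
move=> + + + ge gu hu hg.
have trivial_part rs : u \notin forest_vertices rs ->
    e \notin forest_vertices rs ->
    [seq x <- forest_vertices rs | h x == On] =
    [seq rename u e x | x <- forest_vertices rs & g x == On].
  move=> urs ers; rewrite map_id_in => [|x]; last first.
    rewrite mem_filter /rename => /andP[_ xrs].
    by case: eqVneq => // xe; rewrite xe (negPf ers) in xrs.
  by apply: eq_in_filter => x xrs; rewrite hg //; apply: contraNneq urs => <-.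
(* The gauge [h] is kept abstract because [collapse_gauge] depends on the whole tree, whereas the
   induction passes to subtrees. *)
refine ((@tree_forest_ind V
  (fun t => uniq (vertices t) -> (u, e) \in edges t ->
     gauged (collapse e t) h ->
     on_gauge (collapse e t) h = [seq rename u e x | x <- on_gauge t g])
  (fun ts => forall v, uniq (v :: forest_vertices ts) -> v != u -> v != e ->
    (u, e) \in forest_edges v ts ->
    (forall a b, (a, b) \in forest_edges v (forest_collapse e ts) ->
       h b = Below \/ h b = On -> h a = Below) ->
    [seq x <- forest_vertices (forest_collapse e ts) | h x == On] =
    [seq rename u e x | x <- forest_vertices ts & g x == On])
  _ _ _ _).1 t) => // {t}.
  move=> r ts IH Ut ueE gc; have re := edge_upper_neq_root Ut ueE.
  rewrite /on_gauge.
  have [ru|ru] := eqVneq r u; last first.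
    have ren : rename u e r = r by rewrite /rename (negPf re).
    have := IH r Ut ru re ueE gc.
    rewrite [vertices (collapse _ _)](_ : _ = r :: forest_vertices (forest_collapse e ts)) //.
    rewrite /= hg //; case: ifP => _ E; rewrite /= ?ren E //.
  move: Ut ueE gc; rewrite {re}ru => Ut ueE gc.
  have Uc : uniq (vertices (collapse e (Node u ts))).
    by rewrite (vertices_collapse_edge Ut ueE) filter_uniq.
  have cE : vertices (collapse e (Node u ts)) =
      u :: forest_vertices (forest_collapse e ts) by [].
  (* The root [u] is now on the gauge, so each side of the equation reduces to a single vertex. *)
  have above x : x \in forest_vertices (forest_collapse e ts) -> h x = Above.
    by apply: gauged_above x; [exact: Uc | exact: gc | rewrite hu].
  have /andP[uts Uts] := Ut.
  rewrite cE /= hu eqxx (negPf gu).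
  rewrite (_ : [seq x <- forest_vertices ts | g x == On] = [:: e]); last first.
    rewrite -(filter_pred1_uniq Uts (forest_edges_upper ueE)).
    apply: eq_in_filter => x xts /=; have [->|xe] := eqVneq x e; first by rewrite ge.
    rewrite -hg ?above //; last by apply: contraNneq uts => <-.
    by rewrite forest_vertices_collapse // mem_filter xe.
  rewrite /= /rename eqxx; congr (_ :: _); apply/eqP; rewrite -(negbK (_ == _)) -has_filter.
  by apply/hasPn => x /above ->.
move=> [|w us] rs IHs IHrs v; first exact: IHrs.
rewrite forest_vertices_cons forest_edges_cons forest_collapse_cons.
rewrite cons_uniq mem_cat negb_or cat_uniq.
case/andP=> /andP[vs vrs] /and3P[Us /hasPn sr Urs] vu ve.
rewrite in_cons mem_cat => ueE gc.
(* As [v] is not [u], the edge lies inside the first subtree or inside the remaining ones; the part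
   without it is handled by [trivial_part]. *)
have {}ueE : ((u, e) \in edges (Node w us)) || ((u, e) \in forest_edges v rs).
  by case/or3P: ueE => [/eqP[uv _]|->|->]; rewrite ?orbT //; case/eqP: vu.
have we : w != e.
  case/orP: ueE => [/(edge_upper_neq_root Us)//|/forest_edges_upper/sr].
  by apply: contraNneq => <-; rewrite mem_head.
rewrite forest_vertices_cat !filter_cat map_cat.
move: gc; rewrite (negPf we) forest_edges_cat => gc.
have vc1 : forest_vertices [:: collapse e (Node w us)] = vertices (collapse e (Node w us)).
  by rewrite /forest_vertices /= cats0.
have ec1 : forest_edges v [:: collapse e (Node w us)] =
    (v, w) :: edges (collapse e (Node w us)).
  by rewrite /forest_edges /= cats0.
rewrite vc1.
case/orP: ueE => ueE.
- have ut := edges_lower ueE; have et := edges_upper ueE.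
  have urs : u \notin forest_vertices rs by apply/negP => /sr/negP; apply.
  have ers : e \notin forest_vertices rs by apply/negP => /sr/negP; apply.
  congr (_ ++ _).
    apply: IHs => // a b abE; apply: gc.
    by rewrite mem_cat ec1 in_cons abE orbT.
  by rewrite forest_vertices_collapse // filter_neq_notin // trivial_part.
- have ers := forest_edges_upper ueE.
  have urs : u \in forest_vertices rs.
    by have := forest_edges_lower ueE; rewrite in_cons eq_sym (negPf vu).
  congr (_ ++ _); last first.
    apply: (IHrs v); rewrite /= ?vrs // => a b abE; apply: gc.
    by rewrite mem_cat abE orbT.
  rewrite vertices_collapse // filter_neq_notin ?sr //.
  have := trivial_part [:: Node w us]; rewrite /forest_vertices.
  rewrite [flatten _](_ : _ = vertices (Node w us)) ?/= ?cats0 //.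
  by apply; apply: sr.
Qed.

(** If [e] is on the gauge, then [u] was below it and takes over its place. Otherwise no vertex
    changes side and [rename] fixes all vertices on the gauge. *)
Lemma on_gauge_collapse t (g : V -> side) u e :
    uniq (vertices t) -> (u, e) \in edges t -> gauged t g ->
    gauged (collapse e t) (collapse_gauge t g e) ->
  on_gauge (collapse e t) (collapse_gauge t g e) =
  [seq rename u e x | x <- on_gauge t g].
Proof.
move=> Ut ueE gt gc; rewrite /on_gauge.
have [ge|ge] := eqVneq (g e) On.
  have gu : g u = Below by apply: gt ueE _; right.
  have hu : collapse_gauge t g e u = On by rewrite /collapse_gauge ueE ge.
  have hg : {in predC1 u, collapse_gauge t g e =1 g}.
    move=> x xu; rewrite /collapse_gauge; case: ifP => // /andP[xeE _].
    by rewrite (edge_lower_unique Ut xeE ueE) inE eqxx in xu.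
  by apply: on_gauge_collapse_rename => //; rewrite gu.
rewrite (vertices_collapse_edge Ut ueE) -filter_predI map_id_in => [|x].
  apply: eq_in_filter => x _ /=; rewrite /collapse_gauge (negPf ge) andbF.
  by case: (eqVneq x e) => [->|_]; rewrite ?andbT // (negPf ge).
by rewrite mem_filter /rename; case: (eqVneq x e) => // ->; rewrite (negPf ge).
Qed.

Lemma mem_path_to t x :
  uniq (vertices t) -> x \in internal_edges t -> x \in path_to x t.
Proof.
by move=> Ut /mapP[[a b] abE ->]; rewrite (path_to_edge Ut abE) mem_rcons mem_head.
Qed.

(** Being below the gauge propagates towards the root, so such a path can meet the gauge only at its
    end; this separates the gradients in [free_conormals]. *)
Lemma path_to_below t (g : V -> side) x f :
    uniq (vertices t) -> gauged t g -> x \in vertices t -> g x != Above ->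
  f \in path_to x t -> f = x \/ g f = Below.
Proof.
case: t => // r ts Ut gt xt; move: x xt f.
apply: (vertex_ind (C := fun x => forall f, g x != Above -> f \in path_to x _ -> _)).
  by move=> f _; rewrite path_to_root.
move=> a b abE IH f gb; rewrite (path_to_edge Ut abE) mem_rcons in_cons.
case/orP=> [/eqP->|fa]; [by left | right].
have ga : g a = Below by apply: gt abE _; case: (g b) gb; [left | right |].
by case: (IH f _ fa) => [|->|]; rewrite ?ga.
Qed.

End Collapse.

(** * Determinants *)

Section LinearAlgebra.
Variable R : realFieldType.

Lemma dot_self_eq0 n (z : 'rV[R]_n) : ((z *m z^T) 0 0 == 0) = (z == 0).
Proof.
rewrite mxE; under eq_bigr do rewrite mxE -expr2.
rewrite psumr_eq0 => [|i _]; last exact: sqr_ge0.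
apply/allP/eqP => [z0|-> i _]; last by rewrite mxE expr0n eqxx.
apply/rowP => i; rewrite mxE; apply/eqP.
by have := z0 i; rewrite mem_index_enum sqrf_eq0 => /(_ isT).
Qed.

Lemma dot_self_ge0 n (z : 'rV[R]_n) : 0 <= (z *m z^T) 0 0.
Proof. by rewrite mxE sumr_ge0 // => i _; rewrite mxE -expr2 sqr_ge0. Qed.

(** The vector [c] of cofactors along row [i0] is orthogonal to all other rows. Written as a
    combination [a] of the rows, it involves only rows from [i0] on, so its coordinate [e] is
    [a 0 i0 * M i0 e], while its squared norm is [a 0 i0 * \det M]. The product is thus the squared
    norm times [M i0 e]. *)
Lemma det_cofactor_lt0 n (M : 'M[R]_n) (i0 e : 'I_n) :
    (forall i k : 'I_n, (i < i0)%N -> (i0 <= k)%N -> (M *m M^T) i k = 0) ->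
    (forall k : 'I_n, (i0 < k)%N -> M k e = 0) ->
    M i0 e < 0 -> \det M != 0 ->
  \det M * cofactor M i0 e < 0.
Proof.
move=> Mort Me vlt0 detM.
have MU : M \in unitmx by rewrite unitmxE unitfE.
pose c := col i0 (\adj M).
have Mc : M *m c = \det M *: (delta_mx i0 0 : 'cV_n).
  by rewrite /c colE mulmxA mul_mx_adj mul_scalar_mx.
have rowc (x : 'rV_n) : (x *m M *m c) 0 0 = x 0 i0 * \det M.
  by rewrite -mulmxA Mc -scalemxAr mxE -colE mxE mulrC.
have [a aM] : exists a : 'rV_n, a *m M = c^T.
  by exists (c^T *m invmx M); rewrite mulmxKV.
pose d := \row_i (if (i < i0)%N then a 0 i else 0).
(* The part of [c] in the rows before [i0] is orthogonal both to [c] and to the other part of [c],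
   hence to itself. *)
have z0 : d *m M = 0.
  apply/eqP; rewrite -dot_self_eq0.
  have -> : (d *m M)^T = c - ((a - d) *m M)^T.
    by rewrite mulmxBl aM linearB /= trmxK opprB addrC subrK.
  rewrite mulmxBr mxE rowc [d _ _]mxE ltnn mul0r add0r mxE oppr_eq0.
  rewrite trmx_mul mulmxA -(mulmxA d) mxE big1 // => k _.
  rewrite mxE mulr_suml big1 // => i _; rewrite !mxE.
  case: ltnP => [ii0|_]; last by rewrite !mul0r.
  case: ltnP => [_|i0k]; first by rewrite subrr mulr0.
  by have := Mort i k ii0 i0k; rewrite mxE => ->; rewrite mulr0 mul0r.
have ce : cofactor M i0 e = a 0 i0 * M i0 e.
  have -> : cofactor M i0 e = c^T 0 e by rewrite !mxE.
  rewrite -aM -[a](subrK d) mulmxDl z0 addr0 mxE (bigD1 i0) //= big1 => [|k ki0].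
    by rewrite !mxE ltnn subr0 !addr0.
  rewrite !mxE; case: (ltnP k i0) => [_|i0k]; first by rewrite subrr mul0r.
  by rewrite Me ?mulr0 // ltn_neqAle eq_sym ki0.
have cc : (c^T *m c^T^T) 0 0 = a 0 i0 * \det M by rewrite trmxK -{1}aM rowc.
rewrite ce mulrA [\det M * _]mulrC -cc nmulr_llt0 // lt_neqAle dot_self_ge0 andbT.
(* If [c] were zero, then [M *m c], whose entry [i0] is the determinant, would be zero. *)
rewrite eq_sym dot_self_eq0; apply: contraNneq detM => c0.
have := rowc (delta_mx 0 i0); rewrite -[c]trmxK c0 trmx0 mulmx0 !mxE !eqxx mul1r.
by move=> <-.
Qed.

Lemma free_det_neq0 n (f : seq 'rV[R]_n) :
  free f -> size f = n -> \det (\matrix_(i < n) f`_i) != 0.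
Proof.
move=> ff sf; rewrite -unitfE -unitmxE -row_free_unit; apply: inj_row_free => u.
rewrite mulmx_sum_row => u0; apply/rowP => i; rewrite mxE.
move: (introT eqP sf) => st; have /freeP := ff : free (Tuple st).
apply; rewrite -[RHS]u0; apply: eq_bigr => k _.
by rewrite rowK.
Qed.

(** Past the end [nth] returns the default [0], so the row of index [size f] vanishes. *)
Lemma det_short_eq0 n (f : seq 'rV[R]_n) :
  (size f < n)%N -> \det (\matrix_(i < n) f`_i) = 0.
Proof.
move=> sf; rewrite (expand_det_row _ (Ordinal sf)) big1 // => j _.
by rewrite mxE nth_default // mxE mul0r.
Qed.

Lemma span_orthogonal n (A B : seq 'rV[R]_n) (x y : 'rV[R]_n) :
    {in A & B, forall a b : 'rV_n, (a *m b^T) 0 0 = 0} ->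
  x \in <<A>>%VS -> y \in <<B>>%VS -> (x *m y^T) 0 0 = 0.
Proof.
move=> AB /(coord_span (X := in_tuple A)) -> /(coord_span (X := in_tuple B)) ->.
rewrite mulmx_suml summxE big1 // => i _.
rewrite linear_sum mulmx_sumr summxE big1 // => k _.
by rewrite linearZ /= -scalemxAl -scalemxAr scalerA mxE AB ?mulr0 ?mem_nth.
Qed.

Lemma span_coord_eq0 n (B : seq 'rV[R]_n) (y : 'rV[R]_n) (e : 'I_n) :
  {in B, forall b : 'rV_n, b 0 e = 0} -> y \in <<B>>%VS -> y 0 e = 0.
Proof.
move=> Be /(coord_span (X := in_tuple B)) ->; rewrite summxE big1 // => i _.
by rewrite mxE Be ?mulr0 ?mem_nth.
Qed.

(** The coordinate [e] keeps [v] out of the span of [B], and a vector common to both spans is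
    orthogonal to itself. *)
Lemma free_orthogonal n (A B : seq 'rV[R]_n) (v : 'rV[R]_n) (e : 'I_n) :
    free A -> free B -> {in A & v :: B, forall a b : 'rV_n, (a *m b^T) 0 0 = 0} ->
    {in B, forall b : 'rV_n, b 0 e = 0} -> v 0 e != 0 ->
  free (A ++ v :: B).
Proof.
move=> fA fB AB Be ve; rewrite cat_free fA free_cons fB andbT /=; apply/andP; split.
  by apply: contra ve => /(span_coord_eq0 Be) ->.
apply/directv_addP/eqP; rewrite -subv0; apply/subvP => z.
rewrite memv_cap memv0 => /andP[zA zB]; rewrite -dot_self_eq0.
by rewrite (span_orthogonal AB).
Qed.

(* The Gram matrix of [A ++ v :: B] is block diagonal: expanding the determinant
   along the row of [v] therefore only sees the component of [v] along the
   coordinate [e] that vanishes on [B]. *)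
Lemma sg_det_minor k (A B : seq 'rV[R]_k.+1) (v : 'rV[R]_k.+1) (e : 'I_k.+1) :
    free A -> free B -> {in A & v :: B, forall a b : 'rV_k.+1, (a *m b^T) 0 0 = 0} ->
    {in B, forall b : 'rV_k.+1, b 0 e = 0} -> v 0 e < 0 ->
  Num.sg (\det (\matrix_(i < k.+1) (A ++ v :: B)`_i)) =
  (-1) ^+ (size A + e).+1 *
  Num.sg (\det (\matrix_(i < k, j < k) (A ++ B)`_i 0 (lift e j))).
Proof.
move=> fA fB AB Be ve.
have ff := free_orthogonal fA fB AB Be (ltr0_neq0 ve).
set M := \matrix_(i < k.+1) _; set N := \matrix_(i < k, j < k) _.
have sf : size (A ++ v :: B) = (size (A ++ B)).+1 by rewrite !size_cat addnS.
have : (size (A ++ v :: B) <= k.+1)%N.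
  have /eqP <- := ff; apply: leq_trans (dimvS (subvf _)) _.
  by rewrite dimvf /dim /= mul1n.
(* If the family is too short, both matrices have a zero row and both sides vanish. *)
rewrite leq_eqVlt => /predU1P[sk|]; last first.
  move=> sk; rewrite /M det_short_eq0 // sgr0; move: sk; rewrite sf ltnS => sk.
  rewrite (_ : \det N = 0) ?sgr0 ?mulr0 // (expand_det_row _ (Ordinal sk)).
  by rewrite big1 // => j _; rewrite mxE nth_default // mxE mul0r.
have sAB : (size (A ++ B) = k)%N by apply: succn_inj; rewrite -sf.
have Ak : (size A < k.+1)%N by rewrite ltnS -[leqRHS]sAB size_cat leq_addr.
pose i0 := Ordinal Ak.
have detM : \det M != 0 by apply: free_det_neq0.
have nthv : (A ++ v :: B)`_i0 = v by rewrite nth_cat ltnn subnn.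
have nthA (i : 'I_k.+1) : (i < i0)%N -> (A ++ v :: B)`_i \in A.
  by move=> iA; rewrite nth_cat iA mem_nth.
have nthB (i : 'I_k.+1) : (i0 < i)%N -> (A ++ v :: B)`_i \in B.
  move=> iA; rewrite nth_cat ltnNge ltnW //= -[(i - _)%N]prednK ?subn_gt0 //=.
  rewrite mem_nth // -ltnS prednK ?subn_gt0 // ltn_subLR ?(ltnW iA) //.
  by rewrite addnS -size_cat sAB.
have dotM i l : (M *m M^T) i l = ((A ++ v :: B)`_i *m ((A ++ v :: B)`_l)^T) 0 0.
  by rewrite !mxE; apply: eq_bigr => j _; rewrite !mxE.
have := @det_cofactor_lt0 _ M i0 e; rewrite /cofactor.
have -> : row' i0 (col' e M) = N.
  apply/matrixP => i j; rewrite !mxE; congr (fun_of_matrix _ _ _).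
  rewrite /= /bump !nth_cat; case: (leqP (size A) i) => iA; last by rewrite add0n iA.
  by rewrite add1n ltnNge leqW //= subSn.
move=> /(_ _ _ _ detM) H.
have {H} : \det M * ((-1) ^+ (size A + e) * \det N) < 0.
  apply: H => [i l ii0 i0l|l i0l|]; last by rewrite mxE nthv.
    rewrite dotM AB ?nthA //; move: i0l; rewrite leq_eqVlt => /predU1P[i0l|/nthB].
      by rewrite -i0l nthv mem_head.
    by move=> lB; rewrite in_cons lB orbT.
  by rewrite mxE Be // nthB.
move=> /ltr0_sg; rewrite !sgrM sgrX sgrN1 => H.
(* The sign of [\det M] squares to one, so the inequality determines it from the sign of the
   minor. *)
have s0 : Num.sg (\det M) != 0 by rewrite sgr_eq0.
apply: (mulfI s0); rewrite -expr2 sqr_sg detM exprS mulN1r mulNr mulrN H.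
by rewrite opprK.
Qed.

End LinearAlgebra.

(** * Coordinates on the cones *)

(** The sizes [size w] and [(size (rem e w)).+1] are equal without being convertible. *)
Lemma det_cast (R : comPzRingType) a b (ab : a = b) (A : 'M[R]_a) (B : 'M[R]_b) :
  (forall i j, A i j = B (cast_ord ab i) (cast_ord ab j)) -> \det A = \det B.
Proof.
case: b / ab B => B AB; congr (\det _); apply/matrixP => i j.
by rewrite AB !cast_ord_id.
Qed.

Lemma nth_rem (T : eqType) (d e : T) w k :
  e \in w -> nth d (rem e w) k = nth d w (bump (index e w) k).
Proof.
move=> ew; have iw : (index e w < size w)%N by rewrite index_mem.
rewrite remE nth_cat size_take iw /bump; case: ltnP => ki.
  by rewrite nth_take // add0n.
by rewrite nth_drop addSn subnKC // add1n.
Qed.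

Section Coordinates.
Variables (R : realType) (V : eqType).
Implicit Types (t : tree V) (g : V -> side) (w : seq V) (e f v : V).

Lemma edge_lengthD w (x y : 'rV[R]_(size w).+1) f :
  edge_length (x + y) f = edge_length x f + edge_length y f.
Proof. by rewrite /edge_length; case: ifP; rewrite ?mxE ?addr0. Qed.

Lemma edge_lengthZ w a (x : 'rV[R]_(size w).+1) f :
  edge_length (a *: x) f = a * edge_length x f.
Proof. by rewrite /edge_length; case: ifP; rewrite ?mxE ?mulr0. Qed.

Lemma lambdaD w (x y : 'rV[R]_(size w).+1) : lambda (x + y) = lambda x + lambda y.
Proof. exact: mxE. Qed.

Lemma lambdaZ w a (x : 'rV[R]_(size w).+1) : lambda (a *: x) = a * lambda x.
Proof. exact: mxE. Qed.

Lemma distD t w (x y : 'rV[R]_(size w).+1) v :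
  dist t (x + y) v = dist t x v + dist t y v.
Proof. by rewrite /dist -big_split; apply: eq_bigr => f _; rewrite edge_lengthD. Qed.

Lemma distZ t w a (x : 'rV[R]_(size w).+1) v :
  dist t (a *: x) v = a * dist t x v.
Proof. by rewrite /dist mulr_sumr; apply: eq_bigr => f _; rewrite edge_lengthZ. Qed.

Lemma dist_edge t w (x : 'rV[R]_(size w).+1) a b :
    uniq (vertices t) -> (a, b) \in edges t ->
  dist t x b = dist t x a + edge_length x b.
Proof. by move=> Ut abE; rewrite /dist (path_to_edge Ut abE) big_rcons. Qed.

Definition column w f : 'I_(size w).+1 := inord (index f w).+1.

Lemma column_val w f : f \in w -> column w f = (index f w).+1 :> nat.
Proof. by move=> fw; rewrite /column inordK // ltnS index_mem. Qed.

Lemma column_eq0 w f : f \in w -> (column w f == ord0) = false.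
Proof. by move=> fw; apply/eqP => /(congr1 (@nat_of_ord _)); rewrite column_val. Qed.

Lemma edge_lengthE w (x : 'rV[R]_(size w).+1) f :
  f \in w -> edge_length x f = x 0 (column w f).
Proof. by rewrite /edge_length => ->. Qed.

Lemma conormal_column t w v f : f \in w ->
  conormal R t w v 0 (column w f) = (f \in path_to v t)%:R.
Proof.
move=> fw; rewrite mxE column_eq0 // column_val //= nth_index //.
by case: ifP.
Qed.

Lemma conormal_dot t w (x : 'rV[R]_(size w).+1) v :
    uniq (vertices t) -> ordering t w ->
  (conormal R t w v *m x^T) 0 0 = lambda x + dist t x v.
Proof.
move=> Ut [Uw /perm_mem wt]; rewrite mxE big_ord_recl; congr (_ + _).
  by rewrite !mxE eqxx mul1r.
(* The path follows the depth-first order and [w] an arbitrary one; the sum over the path is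
   rearranged along [w]. *)
have pw : perm_eq (path_to v t) [seq f <- w | f \in path_to v t].
  have sp := path_to_subseq v t.
  apply: uniq_perm; rewrite ?filter_uniq // ?(subseq_uniq sp) ?uniq_internal_edges //.
  move=> f; rewrite mem_filter andb_idr // => fp.
  by rewrite wt (mem_subseq sp).
rewrite /dist (perm_big _ pw) big_filter (big_nth v) big_mkord [RHS]big_mkcond.
apply: eq_bigr => i _; rewrite !mxE /= add0n.
case: ifP => _; rewrite ?mul0r // mul1r edge_lengthE ?mem_nth //; congr (x _ _).
by apply: ord_inj; rewrite column_val ?mem_nth // index_uniq.
Qed.

(** Every vertex on the gauge has a coordinate on which only its own gradient is nonzero. *)
Lemma free_conormals t w g : uniq (vertices t) -> ordering t w -> gauged t g ->
  free [seq conormal R t w v | v <- on_gauge t g].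
Proof.
case: t => [|r ts] Ut [Uw /perm_mem wt] gt; first by rewrite /= nil_free.
set t := Node r ts in Ut wt gt *; set L := on_gauge t g.
have UL : uniq L by rewrite filter_uniq.
have LP v : v \in L -> v \in vertices t /\ g v = On.
  by rewrite mem_filter => /andP[/eqP].
set X := map _ L.
apply/(freeP (X := in_tuple X)) => k k0 i.
have sX : size X = size L by apply: size_map.
have iL : (i < size L)%N by rewrite -[ltnRHS]sX ltn_ord.
have [vt vOn] := LP _ (mem_nth r iL).
(* This coordinate is the edge ending at the vertex. The root has no such edge, but when it is on
   the gauge it is the only vertex there, and [lambda] serves. *)
pose c := if nth r L i == r then ord0 else column w (nth r L i).
have := congr1 (fun z : 'rV_(size w).+1 => z 0 c) k0.
rewrite summxE mxE (bigD1 i) //= big1 => [|l li]; rewrite mxE.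
  rewrite (nth_map r) // addr0 /c => <-; case: eqVneq => [_|vr].
    by rewrite mxE eqxx mulr1.
  have vw : nth r L i \in internal_edges t.
    by move: vt; rewrite internal_edges_Node /= in_cons (negPf vr).
  by rewrite conormal_column ?wt // mem_path_to // mulr1.
have lL : (l < size L)%N by rewrite -[ltnRHS]sX ltn_ord.
have [lt lOn] := LP _ (mem_nth r lL).
have neq : nth r L i != nth r L l.
  by rewrite nth_uniq // eq_sym.
rewrite (nth_map r) // /c; case: eqVneq => [vr|vr].
  have rOn : g r != Below by rewrite -[X in g X]vr vOn.
  have lr : nth r L l != r by rewrite -[X in _ != X]vr eq_sym.
  have := lt; rewrite /= in_cons (negPf lr) /= => /(gauged_above Ut gt rOn).
  by rewrite lOn.
have vw : nth r L i \in internal_edges t.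
  by move: vt; rewrite internal_edges_Node /= in_cons (negPf vr).
rewrite conormal_column ?wt //; case: (boolP (_ \in _)) => [vp|]; last by rewrite mulr0.
case: (path_to_below Ut gt lt _ vp); rewrite ?lOn // ?vOn // => E.
by rewrite E eqxx in neq.
Qed.

Lemma lambda_incl w e (x : 'rV[R]_(size (rem e w)).+1) :
  lambda (collapse_incl x) = lambda x.
Proof. by rewrite /lambda mxE eqxx. Qed.

Lemma edge_length_incl w e (x : 'rV[R]_(size (rem e w)).+1) f :
  edge_length (collapse_incl x) f = edge_length x f.
Proof.
have [fw|fw] := boolP (f \in w).
  by rewrite edge_lengthE // mxE column_eq0 // column_val //= nth_index.
rewrite /edge_length (negPf fw); case: ifP => // /mem_rem.
by rewrite (negPf fw).
Qed.

Lemma edge_length_collapsed w e (x : 'rV[R]_(size (rem e w)).+1) :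
  uniq w -> edge_length x e = 0.
Proof. by move=> Uw; rewrite /edge_length mem_rem_uniqF. Qed.

(** The term of [e] is zero and the paths otherwise agree. *)
Lemma dist_incl t w u e (x : 'rV[R]_(size (rem e w)).+1) v :
    uniq w -> uniq (vertices t) -> (u, e) \in edges t -> v \in vertices t ->
  dist t (collapse_incl x) v = dist (collapse e t) x (rename u e v).
Proof.
move=> Uw Ut ueE vt; rewrite /dist (path_to_collapse Ut ueE vt) big_filter.
rewrite (bigID (fun f => f != e)) /= [X in _ + X]big1 ?addr0 => [|f /negPn/eqP->].
  by apply: eq_bigr => f _; rewrite edge_length_incl.
by rewrite edge_length_incl edge_length_collapsed.
Qed.

(** * Deleting the coordinate of the collapsed edge *)

Section Restriction.
Variables (w : seq V) (e : V).
Hypotheses (Uw : uniq w) (ew : e \in w).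

Lemma size_rem_succ : size w = (size (rem e w)).+1.
Proof.
by rewrite size_rem // prednK // (leq_ltn_trans _ (_ : index e w < size w)%N) ?index_mem.
Qed.

Definition drop_column (z : 'rV[R]_(size w).+1) : 'rV[R]_(size (rem e w)).+1 :=
  \row_k z 0 (lift (column w e) (cast_ord (esym size_rem_succ) k)).

Lemma lift_column_eq0 k :
  (lift (column w e) (cast_ord (esym size_rem_succ) k) == ord0) = (k == ord0).
Proof.
rewrite -!val_eqE /= column_val //; case: (val k) => [|m]; rewrite /bump //.
by rewrite addnS.
Qed.

Lemma nth_lift_column d (k : 'I_(size (rem e w)).+1) : k != ord0 ->
  nth d w (lift (column w e) (cast_ord (esym size_rem_succ) k)).-1 =
  nth d (rem e w) k.-1.
Proof.
rewrite -val_eqE /= column_val //; case: (val k) => //= m _.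
by rewrite nth_rem // /bump ltnS addnS.
Qed.

Lemma drop_column_incl (x : 'rV[R]_(size (rem e w)).+1) :
  drop_column (collapse_incl x) = x.
Proof.
apply/rowP => k; rewrite !mxE lift_column_eq0; case: eqVneq => [->//|k0].
have kw : (k.-1 < size (rem e w))%N.
  by case: k k0 => [[|m]].
rewrite nth_lift_column // edge_lengthE ?mem_nth //; congr (x _ _).
apply: ord_inj; rewrite column_val ?mem_nth // index_uniq ?rem_uniq //.
by case: k k0 {kw} => [[|m]].
Qed.

Lemma drop_column_conormal t u v :
    uniq (vertices t) -> (u, e) \in edges t -> v \in vertices t ->
  drop_column (conormal R t w v) = conormal R (collapse e t) (rem e w) (rename u e v).
Proof.
move=> Ut ueE vt; apply/rowP => k; rewrite !mxE lift_column_eq0.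
case: eqVneq => // k0; rewrite nth_lift_column // (path_to_collapse Ut ueE vt).
have kw : (k.-1 < size (rem e w))%N.
  by case: k k0 => [[|m]].
(* The two gradients read [nth] with different defaults; the index is in range. *)
rewrite (set_nth_default v (rename u e v)) // mem_filter.
suff -> : nth v (rem e w) k.-1 != e by [].
by apply: contraTneq (mem_nth v kw) => ->; rewrite mem_rem_uniqF.
Qed.

Lemma drop_column0 : drop_column 0 = 0.
Proof. by apply/rowP => k; rewrite !mxE. Qed.

(** [drop_column] is a linear left inverse of [collapse_incl], so it carries a linear relation back
    to [b]. *)
Lemma free_incl (b : seq 'rV[R]_(size (rem e w)).+1) :
  free b -> free [seq collapse_incl y | y <- b].
Proof.
move=> fb; apply/(freeP (X := in_tuple (map _ b))) => k k0 i.
have sb : size [seq collapse_incl y | y <- b] == size b by rewrite size_map.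
have /freeP : free (in_tuple b) by [].
move=> /(_ (fun i => k (cast_ord (esym (eqP sb)) i))) fk.
rewrite -(cast_ordK (eqP sb) i); apply: fk.
rewrite -[RHS]drop_column0 -[in RHS]k0.
apply/rowP => l; rewrite summxE mxE summxE (reindex (cast_ord (eqP sb))); last first.
  by exists (cast_ord (esym (eqP sb))) => l' _; rewrite ?cast_ordK ?cast_ordKV.
apply: eq_bigr => l' _; rewrite cast_ordK !mxE (nth_map 0) -?(eqP sb) //.
by have /rowP/(_ l) := drop_column_incl b`_l'; rewrite mxE => ->.
Qed.

Lemma det_drop_column (f : seq 'rV[R]_(size w).+1) :
  \det (\matrix_(i < size w, j < size w) f`_i 0 (lift (column w e) j)) =
  \det (\matrix_(i < (size (rem e w)).+1) [seq drop_column z | z <- f]`_i).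
Proof.
apply: (det_cast (ab := size_rem_succ)) => i j; rewrite !mxE /=.
have [fi|fi] := ltnP i (size f); last by rewrite !nth_default ?size_map // !mxE.
by rewrite (nth_map 0) // mxE cast_ordK.
Qed.

End Restriction.
End Coordinates.

(** * The boundary *)

Section Boundary.
Variables (R : realType) (V : eqType) (t : tree V) (g : V -> side).
Variables (w : seq V) (u e : V).
Hypotheses (Ut : uniq (vertices t)) (tw : ordering t w).
Hypotheses (gt : gauged t g) (ueE : (u, e) \in edges t).
Hypothesis gc : gauged (collapse e t) (collapse_gauge t g e).

Local Notation stratum := (@collapse_CT R V t g w e).

Let Uw : uniq w. Proof. by case: tw. Qed.

Let ew : e \in w.
Proof. by case: tw => _ /perm_mem->; apply/mapP; exists (u, e). Qed.

(** An edge not crossed by the gauge is an edge of the coloured tree, so its length is a continuous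
    coordinate; a negative value would give a neighbourhood missing the cone. *)
Lemma CTbar_edge_length_ge0 (x : 'rV[R]_(size w).+1) : ~~ intersects g (u, e) ->
  CTbar R t g w (coloured_lengths t g x) -> 0 <= edge_length x e.
Proof.
move=> nue clx; rewrite leNgt; apply/negP => xe.
have ceE : (Some u, Some e) \in coloured_edges t g.
  rewrite /coloured_edges !mem_cat; apply/orP; right; apply/orP; left.
  by apply/flatten_mapP; exists (u, e); rewrite // (negPf nue) mem_head.
have kP : (index (Some u, Some e) (coloured_edges t g) < size (coloured_edges t g))%N.
  by rewrite index_mem.
pose k := Ordinal kP.
have lenk (z : 'rV[R]_(size w).+1) : coloured_lengths t g z k = (edge_length z e)%:E.
  by rewrite /coloured_lengths nth_index //= (dist_edge _ Ut ueE) addrAC subrr add0r.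
have [z [[p [pe _] <-]] ] : ((coloured_lengths t g @` CT t g w) `&`
    (proj k @^-1` [set l : \bar R | (l < 0)%E]) !=set0)%classic.
  apply: clx; apply: proj_continuous; apply: open_nbhs_nbhs; split.
    exact: open_ereal_lt_ereal.
  by rewrite /= /proj lenk lte_fin.
by rewrite /= /proj lenk lte_fin ltNge ltW // pe.
Qed.

Lemma on_gauge_dist (x : 'rV[R]_(size (rem e w)).+1) v :
    stratum x -> v \in on_gauge t g ->
  lambda x + dist (collapse e t) x (rename u e v) = 0.
Proof.
move=> [_ xv] vg.
have : rename u e v \in on_gauge (collapse e t) (collapse_gauge t g e).
  by rewrite (on_gauge_collapse Ut ueE gt gc) map_f.
rewrite mem_filter => /andP[/eqP gv vc].
by have := xv _ vc; rewrite gv => <-; rewrite subrr.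
Qed.

(* The half-open segment from a point of the cone to a point of the stratum stays
   in the cone: on the stratum the strict inequalities of the cone hold weakly. *)
Lemma segment_CT (x : 'rV[R]_(size (rem e w)).+1) (z : 'rV[R]_(size w).+1) s :
    ~~ intersects g (u, e) -> stratum x -> CT t g w z -> 0 < s < 1 ->
  CT t g w ((1 - s) *: collapse_incl x + s *: z).
Proof.
move=> nue xc [ze zv] /andP[s0 s1]; have r0 : 0 < 1 - s by rewrite subr_gt0.
have [xe xv] := xc; split=> [f fw|v vt].
  rewrite edge_lengthD !edge_lengthZ edge_length_incl ltr_wpDl ?mulr_gt0 ?ze //.
  rewrite mulr_ge0 ?(ltW r0) //; have [->|fe] := eqVneq f e.
    by rewrite edge_length_collapsed.
  by rewrite ltW // xe // mem_rem_uniq // inE fe.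
have vc := rename_vertices_collapse Ut ueE vt.
have := xv _ vc; have := zv _ vt.
rewrite !(distD, distZ, lambdaD, lambdaZ) lambda_incl (dist_incl x Uw Ut ueE vt).
case gv: (g v) => zgv xgv.
(* If [v] is merged with an upper end on the gauge, its strict inequality becomes an equality. *)
- have xle : dist (collapse e t) x (rename u e v) <= - lambda x.
    move: xgv; rewrite /collapse_gauge; case: ifP => [_ <-//|].
    rewrite /rename; case: eqVneq gv => [->|_] gv; last by rewrite gv => _ /ltW.
    by rewrite (gt ueE) ?gv; [move=> _ /ltW | left].
  have := ler_wpM2l (ltW r0) xle; have := zgv; rewrite -(ltr_pM2l s0); lra.
- have vg : v \in on_gauge t g by rewrite mem_filter gv vt.
  have := on_gauge_dist xc vg => xon; have : lambda z + dist t z v = 0 by lra.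
  by move=> zon; apply/eqP; rewrite -subr_eq0; apply/eqP; nra.
- have xle : - lambda x <= dist (collapse e t) x (rename u e v).
    move: xgv; rewrite /collapse_gauge; case: ifP => [_ ->//|].
    rewrite /rename; case: eqVneq gv => [->|_] gv; last by rewrite gv => _ /ltW.
    (* Here [v] is [e], and [u] is not below the gauge since the gauge does not cross the edge. *)
    move: nue; rewrite /intersects /= gv eqxx andbT.
    by case: (g u) => //= _ _ => [->//|/ltW].
  have := ler_wpM2l (ltW r0) xle; have := zgv; rewrite -(ltr_pM2l s0); lra.
Qed.

(** The vector from a point of the cone to the boundary point works: backwards it follows the
    segment inside the cone, forwards it makes the length of [e] negative. *)
Lemma exists_outward (x : 'rV[R]_(size (rem e w)).+1) :
    ~~ intersects g (u, e) -> stratum x -> nonempty (CT t g w : set 'rV[R]_(size w).+1) ->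
  exists v, outward t g (collapse_incl x) v.
Proof.
move=> nue xc [z zC]; exists (collapse_incl x - z); exists 1 => // s s01; split.
  rewrite (_ : _ - _ = (1 - s) *: collapse_incl x + s *: z); first exact: segment_CT.
  by rewrite scalerBr scalerBl scale1r opprB addrA addrAC -addrA.
move=> /(CTbar_edge_length_ge0 nue).
rewrite -[- z]scaleN1r !(edge_lengthD, edge_lengthZ) edge_length_incl.
rewrite edge_length_collapsed // !add0r mulN1r leNgt => /negP; apply.
by case: zC => /(_ _ ew) ze _; case/andP: s01 => s0 _; rewrite mulrN oppr_lt0 mulr_gt0.
Qed.

Lemma outward_edge_length_lt0 (x : 'rV[R]_(size (rem e w)).+1) v :
  outward t g (collapse_incl x) v -> edge_length v e < 0.
Proof.
move=> [d d0 /(_ (d / 2))]; have d20 : 0 < d / 2 by lra.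
case=> [|[/(_ _ ew) + _] _]; first lra.
rewrite -scaleNr edge_lengthD edge_lengthZ edge_length_incl edge_length_collapsed //.
by rewrite add0r mulNr oppr_gt0 pmulr_rlt0.
Qed.

(** The linear form [lambda] plus distance to [c] vanishes at the boundary point and at a nearby
    point of the cone, hence on their difference, a multiple of [v]. *)
Lemma outward_conormal (x : 'rV[R]_(size (rem e w)).+1) v c :
    stratum x -> outward t g (collapse_incl x) v -> c \in on_gauge t g ->
  (conormal R t w c *m v^T) 0 0 = 0.
Proof.
move=> xc [d d0 /(_ (d / 2))] + cg; have d20 : 0 < d / 2 by lra.
have := cg; rewrite mem_filter => /andP[/eqP gC ct].
case=> [|[_ /(_ _ ct) +] _]; first lra.
rewrite gC -scaleNr !(lambdaD, lambdaZ, distD, distZ) lambda_incl.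
rewrite (dist_incl x Uw Ut ueE ct) conormal_dot //.
have := on_gauge_dist xc cg => xon H.
by apply: (mulfI (lt0r_neq0 d20)); rewrite mulr0; lra.
Qed.

Lemma tangent_conormal (x y : 'rV[R]_(size (rem e w)).+1) c :
    stratum x -> tangent stratum x y -> c \in on_gauge t g ->
  (conormal R t w c *m (collapse_incl y)^T) 0 0 = 0.
Proof.
move=> xc /nbhs_ballP[d /= d0 dP] cg.
have d20 : 0 < d / 2 by lra.
have := cg; rewrite mem_filter => /andP[_ ct].
have /on_gauge_dist/(_ cg) : stratum (x + (d / 2) *: y).
  by apply: dP; rewrite /ball /= sub0r normrN gtr0_norm //; lra.
rewrite conormal_dot // lambda_incl (dist_incl y Uw Ut ueE ct).
rewrite !(lambdaD, lambdaZ, distD, distZ).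
have := on_gauge_dist xc cg => xon H.
by apply: (mulfI (lt0r_neq0 d20)); rewrite mulr0; lra.
Qed.

Lemma orientation_collapse (x : 'rV[R]_(size (rem e w)).+1) v b :
    stratum x -> outward t g (collapse_incl x) v ->
    tangent_basis stratum x b ->
  orientation t g (v :: [seq collapse_incl y | y <- b]) =
  (-1) ^+ (size (on_gauge t g) + index e w) *
  orientation (collapse e t) (collapse_gauge t g e) b.
Proof.
move=> xc vout [fb tb].
have ve := outward_edge_length_lt0 vout.
rewrite edge_lengthE // in ve.
rewrite /orientation (sg_det_minor (e := column w e)) //; first last.
- by move=> _ /mapP[y yb ->]; rewrite -edge_lengthE // edge_length_incl edge_length_collapsed.
- move=> _ z /mapP[c cg ->]; rewrite in_cons => /predU1P[->|/mapP[y yb ->]].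
    exact: outward_conormal vout cg.
  by apply: tangent_conormal xc _ cg; apply/tb/memv_span.
- exact: free_incl.
- exact: free_conormals.
(* Two minus signs cancel: one from the negative coordinate of [v], one from the shift of columns by
   [lambda]. *)
rewrite size_map column_val // addnS !exprS mulN1r mulN1r opprK; congr (_ * Num.sg _).
rewrite det_drop_column //; congr (\det _); apply/matrixP => i k; rewrite !mxE.
congr (fun_of_matrix (nth _ _ _) _ _).
(* The minor consists of the gradients for the collapsed tree followed by [b]. *)
rewrite map_cat -!map_comp (on_gauge_collapse Ut ueE gt gc); congr (_ ++ _).
  rewrite -map_comp; apply/eq_in_map => c; rewrite mem_filter => /andP[_ ct].
  by rewrite /= (drop_column_conormal R Uw ew Ut ueE).
by rewrite -[RHS]map_id; apply: eq_map => y; rewrite /= drop_column_incl.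
Qed.

End Boundary.

Theorem proposition8 (R : realType) (V : eqType) (n : nat) (t : tree V)
    (g : V -> side) (w : seq V) (j p : nat) (ep : V)
    (hn : (2 <= n)%N) (ht : ribbon_tree t) (hs : stable t) (ha : arity t = n)
    (hg : gauged t g) (hj : size (on_gauge t g) = j)
    (hw : ordering t w)
    (hp : (0 < p)%N) (hep : onth w p.-1 = Some ep)
    (hc : int_collapse R t g w ep) :
  collapse_bears_sign t g w ep ((-1) ^+ (p + 1 + j) : R).
Proof.
have [_ Ut] := ht; have [Uw wt] := hw.
have wp : nth ep w p.-1 = ep by apply: onth_nth.
have pw : (p.-1 < size w)%N by rewrite ltnNge; apply: contraPN hep => /onth_default->.
have [u ueE] : exists u, (u, ep) \in edges t.
  have : ep \in internal_edges t by rewrite -(perm_mem wt) -wp mem_nth.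
  by move=> /mapP[[u e] ueE ->]; exists u.
(* The dimension clause provides the point of the cone from which an outward vector is built. *)
have [nue gc _ [d _ [CT0 _]]] := hc.
have nuep := nue _ ueE.
move=> x xc; split=> [|v b vout tb].
  exact: (exists_outward Ut hw hg ueE gc nuep xc CT0).
rewrite (orientation_collapse Ut hw hg ueE gc xc vout tb) hj.
have -> : index ep w = p.-1 by rewrite -[in LHS]wp index_uniq.
(* Positions count from one in [p] and from zero in [index]; the exponents [j + p.-1] and
   [p + 1 + j] differ by two. *)
congr (_ * _); rewrite -[in RHS](prednK hp) addn1 !addSn !exprS.
by rewrite !mulN1r opprK addnC.
Qed.
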